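(* Let $r\ge0$ be a fixed integer and let $Y\in\Omega_n^r$ be a random simplicial complex with respect to $\mathbb{P}_{r,\mathfrak p}$, where $\mathfrak p=(p_0,\dots,p_r)$, $p_i=n^{-\alpha_i}$, and the vector of exponents $\alpha=\alpha(n)=(\alpha_0,\dots,\alpha_r)\in\mathbb{R}^{r+1}_+$ converges to a vector $\alpha_\ast\in\mathbb{R}^{r+1}_+$. Assume that $\alpha_\ast\in\mathfrak{D}_k$ for some $k\ge 0$. Let $0\le d\le r$ be an integer and $0<\delta<1$ a constant. (1) Assume that $d<k$ and $\psi_{d+1}(\alpha_\ast)>0$. Put $\mu=\mu(n,d,\alpha)=n^{1-\psi_{d+1}(\alpha)}$ and $\mathcal{T}(n,\delta)=\{s\in\mathbb{N}\cup\{0\}:|s-\mu|>\delta\mu\}$. Then $$\sum_{s\in\mathcal{T}(n,\delta)}f_{d,s}(Y)=0,\quad\text{a.a.s.}$$ In other words, with probability tending to one, the degree $s$ of every $d$-dimensional simplex of $Y$ satisfies $|s-\mu|\le\delta\mu$. (2) Assume that $d\ge k$ and $\tau_d(\alpha_\ast)>0$. Then there exists a sequence $t=t(n)>0$ tending to $0$ such that $$\frac{f_{d,0}(Y)}{f_d(Y)}>1-t,\quad\text{a.a.s.}$$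
   Context: Model. Let $\Delta_n$ be the simplex with vertex set $\{1,\dots,n\}$, viewed as an abstract simplicial complex. For a subcomplex $Y\subset\Delta_n$, $f_i(Y)$ is the number of $i$-dimensional simplexes of $Y$, and $e_i(Y)$ is the number of $i$-dimensional external faces of $Y$, i.e. $i$-simplexes $\sigma\subset\Delta_n$ with $\sigma\not\subset Y$ but $\partial\sigma\subset Y$ (for $i=0$: vertices not in $Y$). $\Omega_n^r$ is the set of all subcomplexes $Y\subset\Delta_n$ with $\dim Y\le r$ (including the empty one). For $\mathfrak p=(p_0,\dots,p_r)$ with $0\le p_i\le 1$ the probability measure on $\Omega_n^r$ is $$\mathbb{P}_{r,\mathfrak p}(Y)=\prod_{i=0}^r p_i^{f_i(Y)}\cdot\prod_{i=0}^r(1-p_i)^{e_i(Y)},\qquad 0^0=1.$$ Notation. $\mathbb{R}_+=[0,\infty)$. For $\alpha=(\alpha_0,\dots,\alpha_r)$ and $k=0,\dots,r$ put $$\psi_k(\alpha)=\sum_{i=0}^r\binom{k}{i}\alpha_i,\qquad \tau_k(\alpha)=\sum_{i=0}^k[1-\psi_i(\alpha)],$$ with $\binom{k}{i}=0$ for $i>k$ and $\binom00=1$. Domains: $\mathfrak{D}_k=\{\alpha\in\mathbb{R}^{r+1}_+:\psi_k(\alpha)<1<\psi_{k+1}(\alpha)\}$ for $0\le k\le r-1$, and $\mathfrak{D}_r=\{\alpha\in\mathbb{R}^{r+1}_+:\psi_r(\alpha)<1\}$. The degree $\deg_Y(\sigma)$ of a $d$-simplex $\sigma$ of $Y$ is the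 number of $(d+1)$-simplexes of $Y$ containing $\sigma$. $f_{d,s}(Y)$ is the number of $d$-simplexes of $Y$ having degree exactly $s$. ''A.a.s.'' means with probability tending to $1$ as $n\to\infty$ (in (2) this includes $f_d(Y)>0$). *)

(* Defs.v *)
From mathcomp Require Import all_boot all_order all_algebra.
From mathcomp Require Import all_classical all_reals all_analysis.
Set Implicit Arguments.
Unset Strict Implicit.
Unset Printing Implicit Defensive.
Import Order.TTheory GRing.Theory Num.Theory.
Import numFieldNormedType.Exports.
Local Open Scope ring_scope.

(* A subcomplex of the simplex on the vertex set 'I_n is encoded by the set of
   its nonempty faces, so that an i-simplex is a face of cardinality i.+1 and
   finset.set0 is the empty complex. *)
Definition is_complex (n : nat) (Y : {set {set 'I_n}}) : bool :=
  (finset.set0 \notin Y) &&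
  [forall s in Y, forall t : {set 'I_n},
     (t != finset.set0) && (t \subset s) ==> (t \in Y)].

Definition Omega (n r : nat) : {set {set {set 'I_n}}} :=
  [set Y | is_complex Y && [forall s in Y, #|s| <= r.+1]%N]%SET.

Definition faces (n : nat) (i : nat) (Y : {set {set 'I_n}}) : {set {set 'I_n}} :=
  [set s in Y | #|s| == i.+1]%SET.

(* For i = 0 the boundary condition is vacuous: these are the vertices not in Y. *)
Definition ext_faces (n : nat) (i : nat) (Y : {set {set 'I_n}}) :
    {set {set 'I_n}} :=
  [set s : {set 'I_n} | [&& #|s| == i.+1, s \notin Y &
     [forall t : {set 'I_n}, (t != finset.set0) && (t \proper s) ==> (t \in Y)]]]%SET.

Definition deg (n : nat) (Y : {set {set 'I_n}}) (s : {set 'I_n}) : nat :=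
  #|[set t in Y | (s \subset t) && (#|t| == #|s|.+1)]%SET|.

Definition faces_deg (n : nat) (d s : nat) (Y : {set {set 'I_n}}) :
    {set {set 'I_n}} :=
  [set x in faces d Y | deg Y x == s]%SET.

(* The convention 0 ^ 0 = 1 is that of ^+. *)
Definition weight (R : realType) (n r : nat) (p : 'rV[R]_r.+1)
    (Y : {set {set 'I_n}}) : R :=
  (\prod_(i < r.+1) p 0 i ^+ #|faces i Y|) *
  (\prod_(i < r.+1) (1 - p 0 i) ^+ #|ext_faces i Y|).

Definition Pr (R : realType) (n r : nat) (p : 'rV[R]_r.+1)
    (E : set {set {set 'I_n}}) : R :=
  \sum_(Y in Omega n r | `[< E Y >]) weight p Y.

Definition aas (R : realType) (r : nat) (p : nat -> 'rV[R]_r.+1)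
    (E : forall n : nat, set {set {set 'I_n}}) : Prop :=
  ((fun n : nat => Pr (p n) (E n)) @ \oo --> (1 : R))%classic.

Definition prob_of_exponents (R : realType) (r : nat) (a : nat -> 'rV[R]_r.+1)
    (n : nat) : 'rV[R]_r.+1 :=
  \row_i (n%:R `^ (- a n 0 i)).

Definition nonneg (R : realType) (r : nat) (a : 'rV[R]_r.+1) : Prop :=
  forall i : 'I_r.+1, 0 <= a 0 i.

Definition psi (R : realType) (r : nat) (k : nat) (a : 'rV[R]_r.+1) : R :=
  \sum_(i < r.+1) 'C(k, i)%:R * a 0 i.

Definition tau (R : realType) (r : nat) (k : nat) (a : 'rV[R]_r.+1) : R :=
  \sum_(i < k.+1) (1 - psi i a).

(* Only meaningful for k <= r; the second branch is the case k = r. *)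
Definition Dom (R : realType) (r : nat) (k : nat) : set 'rV[R]_r.+1 :=
  if (k < r)%N then [set a | nonneg a /\ psi k a < 1 < psi k.+1 a]%classic
  else [set a | nonneg a /\ psi k a < 1]%classic.

Definition mu (R : realType) (r : nat) (n d : nat) (a : 'rV[R]_r.+1) : R :=
  n%:R `^ (1 - psi d.+1 a).

Definition Tset (R : realType) (m delta : R) : set nat :=
  [set s : nat | delta * m < `|s%:R - m|]%classic.

(* Main.v *)
Require Import Defs.
From mathcomp Require Import all_boot all_order all_algebra.
From mathcomp Require Import all_classical all_reals all_analysis.
From mathcomp Require Import ring lra zify.
Import Order.TTheory GRing.Theory Num.Theory.
Import numFieldNormedType.Exports.
Set Implicit Arguments.
Unset Strict Implicit.
Local Open Scope set_scope.
Local Open Scope ring_scope.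

(** The random complex is obtained from independent choices: keep every simplex
    [s] of dimension at most [r] independently with probability [p_(dim s)], and
    let [core X] be the largest complex inside the resulting random set [X].
    A complex [Y] equals [core X] exactly when [X] contains [Y] and misses the
    external faces of [Y], so that [core X] has the prescribed law
    ([weight_core], [Pr_core]).  All probabilities then reduce to
    P(A is contained in X) = the product of the probabilities of the elements
    of [A] ([Ex_supset]).

    Degrees.  Let [s] have [m] vertices and let [v] be a vertex outside [s].
    If [s] is a face, then [v |: s] is a face exactly when the simplices
    [v |: u], [u] a subset of [s], were all kept: an event of probability
    n^(- psi_m).  For distinct [v] these events concern disjoint families of
    simplices, hence are independent, also of the event that [s] is a face.
    Given that [s] is a face, its degree is thus binomial with parameters
    [n - m] and n^(- psi_m), of mean close to mu = n^(1 - psi_m).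

    Part (1).  Exponential moments of this binomial give a deviation bound
    exp(- kappa * mu) with kappa > 0 ([Ex_tilt_le]).  Here [m = d.+1 <= k], so
    psi_m <= psi_k < 1 in the limit and mu grows like a positive power of [n]:
    the bound survives the union over the at most n^m faces
    ([Pr_all_degrees_ge], [cvg_poly_expR0]).

    Part (2).  The number of [d]-faces has a mean [M] of order n^(tau_d).  Two
    [d]-simplices sharing [j] vertices contribute to the relative variance at
    most a constant times n^(- tau_(j-1)) ([sum_overlap_le]).  Since psi_i is
    nondecreasing in [i], tau is concave in its index, so tau_d > 0 forces
    tau_j > 0 for every [j <= d] ([le_tau_min]), and by Chebyshev there are at
    least M/2 faces a.a.s.  The mean number of [d]-faces of positive degree is
    at most M * n^(1 - psi_(d+1)) ([Ex_covered_faces_le]), and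
    psi_(d+1) >= psi_(k+1) > 1 in the limit, so it is at most M * eps with
    eps -> 0; Markov's inequality leaves a proportion below 2 * sqrt eps
    ([Pr_most_faces_isolated_ge]).  When [d = r] no face has positive degree. *)

(** * Random subsets with independent elements *)

Section RandomSubset.
Variables (R : realFieldType) (T : finType) (P : T -> R).

Definition subset_weight (X : {set T}) : R :=
  \prod_t (if t \in X then P t else 1 - P t).

Definition Ex (f : {set T} -> R) : R := \sum_X subset_weight X * f X.

Lemma eq_Ex f g : f =1 g -> Ex f = Ex g.
Proof. by move=> fg; apply: eq_bigr => X _; rewrite fg. Qed.

Lemma ExD f g : Ex (fun X => f X + g X) = Ex f + Ex g.
Proof. by rewrite -big_split; apply: eq_bigr => X _; rewrite mulrDr. Qed.

Lemma ExZ c f : Ex (fun X => c * f X) = c * Ex f.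
Proof. by rewrite [RHS]mulr_sumr; apply: eq_bigr => X _; rewrite mulrCA. Qed.

Lemma Ex_sum (I : Type) (s : seq I) (Q : pred I) (f : I -> {set T} -> R) :
  Ex (fun X => \sum_(i <- s | Q i) f i X) = \sum_(i <- s | Q i) Ex (f i).
Proof.
rewrite [RHS]exchange_big; apply: eq_bigr => X _; exact: mulr_sumr.
Qed.

(** Prescribing the membership of the elements of [A] (in) and [B] (out) leaves
    the other factors free, and each of these sums to [P t + (1 - P t) = 1]. *)
Lemma sum_subset_weight_between (A B : {set T}) : [disjoint A & B] ->
  \sum_(X : {set T} | (A \subset X) && [disjoint B & X]) subset_weight X =
    (\prod_(t in A) P t) * \prod_(t in B) (1 - P t).
Proof.
move=> dAB.
pose F t := if t \in B then 0 else P t.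
pose G t := if t \in A then 0 else 1 - P t.
have -> : (\prod_(t in A) P t) * \prod_(t in B) (1 - P t) = \prod_t (F t + G t).
  rewrite (big_mkcond (mem A)) (big_mkcond (mem B)) -big_split /=.
  apply: eq_bigr => t _; rewrite /F /G.
  case: (boolP (t \in A)) => tA; last by case: (t \in B); rewrite /=; lra.
  by rewrite (disjointFr dAB tA) mulr1 addr0.
rewrite bigA_distr big_mkcond; apply: eq_bigr => X _ /=.
case: ifP => [/andP[AX BX]|].
  apply: eq_bigr => t _; rewrite /F /G; case: ifP => tX.
    by rewrite (disjointFl BX tX).
  by case: (boolP (t \in A)) => // /(fintype.subsetP AX); rewrite tX.
move=> /negbT; rewrite negb_and => /orP[/fintype.subsetPn[t tA tX]|].
  by rewrite (bigD1 t) //= (negbTE tX) /G tA mul0r.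
rewrite -finset.setI_eq0 => /finset.set0Pn[t]; rewrite inE => /andP[tB tX].
by rewrite (bigD1 t) //= tX /F tB mul0r.
Qed.

Lemma Ex_supset (A : {set T}) :
  Ex (fun X => (A \subset X)%:R) = \prod_(t in A) P t.
Proof.
have := @sum_subset_weight_between A finset.set0.
rewrite disjoint_sym finset.disjoints_subset finset.sub0set => /(_ isT).
rewrite [X in _ * X]big_pred0 ?mulr1; last by move=> t; rewrite inE.
move=> <-; rewrite [RHS]big_mkcond /=; apply: eq_bigr => X _.
by rewrite finset.disjoints_subset finset.sub0set andbT; case: ifP; rewrite (mulr1, mulr0).
Qed.

Lemma Ex1 : Ex (fun=> 1) = 1.
Proof.
transitivity (\prod_(t in (finset.set0 : {set T})) P t).
  rewrite -Ex_supset; apply: eq_Ex => X; by rewrite finset.sub0set.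
by rewrite finset.big_set0.
Qed.

Lemma Ex_sqr_dist (f : {set T} -> R) :
  Ex (fun X => (f X - Ex f) ^+ 2) = Ex (fun X => f X ^+ 2) - Ex f ^+ 2.
Proof.
set m := Ex f.
rewrite (@eq_Ex _ (fun X => f X ^+ 2 + ((- 2 * m) * f X + m ^+ 2 * 1))); last first.
  by move=> X; ring.
by rewrite !ExD !ExZ Ex1 -/m; ring.
Qed.

(** Independence of the events [B i \subset X] for disjoint blocks, in the form
    of a generating function: both products are expanded over the subsets [J]
    of indices, and containing all blocks of [J] means containing their union. *)
Lemma Ex_prod_blocks (I : finType) (B : I -> {set T}) (c : I -> R) :
    (forall i j, i != j -> [disjoint B i & B j]) ->
  Ex (fun X => \prod_i (1 + c i * (B i \subset X)%:R)) =
    \prod_i (1 + c i * \prod_(t in B i) P t).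
Proof.
move=> dB; under [RHS]eq_bigr => i _ do rewrite addrC.
rewrite bigA_distr.
transitivity (Ex (fun X : {set T} => \sum_(J : {set I})
    (\prod_(i in J) c i) * ((\bigcup_(i in J) B i) \subset X)%:R)).
  apply: eq_Ex => X; under eq_bigr => i _ do rewrite addrC.
  rewrite bigA_distr; apply: eq_bigr => J _.
  rewrite -big_mkcond big_split /=; congr (_ * _).
  case: (boolP (_ \subset X)) => [/bigcupsP BX|].
    by rewrite big1 // => i /BX ->.
  move=> BX; suff /exists_inP[i iJ /negbTE BiX] : [exists i in J, ~~ (B i \subset X)].
    by rewrite (bigD1 i) //= BiX mul0r.
  apply: contraR BX; rewrite negb_exists_in => /forall_inP BX.
  by apply/bigcupsP => i /BX; rewrite negbK.
rewrite Ex_sum; apply: eq_bigr => J _.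
rewrite ExZ Ex_supset -big_mkcond big_split /=; congr (_ * _).
(* Emptying the other blocks turns the union over [J] into one over all indices. *)
pose B' i := if i \in J then B i else finset.set0.
have dB' i j : i != j -> [disjoint B' i & B' j].
  move=> /dB; rewrite /B'; case: (i \in J); case: (j \in J) => // _.
  - by rewrite disjoint_sym finset.disjoints_subset finset.sub0set.
  - by rewrite finset.disjoints_subset finset.sub0set.
  - by rewrite finset.disjoints_subset finset.sub0set.
have -> : \bigcup_(i in J) B i = \bigcup_i B' i by rewrite big_mkcond.
rewrite (finset.partition_disjoint_bigcup _ P dB') [RHS]big_mkcond; apply: eq_bigr => i _.
by rewrite /B'; case: ifP => // _; rewrite finset.big_set0.
Qed.

Hypothesis P01 : forall t, 0 <= P t <= 1.

Lemma subset_weight_ge0 X : 0 <= subset_weight X.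
Proof. by apply: prodr_ge0 => t _; have := P01 t; case: ifP => _; lra. Qed.

Lemma Ex_le f g : (forall X, f X <= g X) -> Ex f <= Ex g.
Proof.
by move=> fg; apply: ler_sum => X _; apply: ler_wpM2l (fg X); exact: subset_weight_ge0.
Qed.

End RandomSubset.

(** * The random complex as the core of a random set of simplices *)

Section Core.
Variables (n r : nat).
Local Notation S := {set 'I_n}.
Implicit Types (s t : S) (X Y : {set S}).

Definition below s : {set S} := [set t : S | (t != finset.set0) && (t \subset s)].

Definition core X : {set S} :=
  [set s : S | [&& s != finset.set0, (#|s| <= r.+1)%N & below s \subset X]].

(** The external faces of dimension at most [r], all dimensions together. *)
Definition missing_faces Y : {set S} :=
  [set s : S | [&& s != finset.set0, (#|s| <= r.+1)%N, s \notin Y &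
     below s :\ s \subset Y]].

Lemma below_self s : s != finset.set0 -> s \in below s.
Proof. by move=> s0; rewrite inE s0 fintype.subxx. Qed.

Lemma belowS s t : t \subset s -> below t \subset below s.
Proof.
move=> ts; apply/fintype.subsetP => u; rewrite !inE => /andP[-> ut].
exact: fintype.subset_trans ut ts.
Qed.

Lemma mem_core X s : s \in core X -> s \in X.
Proof.
rewrite inE => /and3P[s0 _ /fintype.subsetP]; apply; exact: below_self.
Qed.

Lemma core_Omega X : core X \in Omega n r.
Proof.
rewrite inE; apply/andP; split; last first.
  by apply/forall_inP => s; rewrite inE => /and3P[].
apply/andP; split; first by rewrite inE eqxx.
apply/forall_inP => s; rewrite inE => /and3P[s0 sr sX].
apply/forall_inP => t /andP[t0 ts]; rewrite inE t0 /=.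
rewrite (leq_trans (subset_leq_card ts) sr) /=.
exact: fintype.subset_trans (belowS ts) sX.
Qed.

Lemma OmegaP Y : Y \in Omega n r ->
  forall s, s \in Y -> [/\ s != finset.set0, (#|s| <= r.+1)%N & below s \subset Y].
Proof.
rewrite inE => /andP[/andP[Y0 /forall_inP Ysub] /forall_inP Yr] s sY; split.
- by apply: contraNneq Y0 => <-.
- exact: Yr.
- apply/fintype.subsetP => t; rewrite inE => tb.
  by have /forall_inP := Ysub _ sY; apply.
Qed.

(** From right to left, suppose that some simplex of [core X] is not in [Y] and
    take a smallest one: its proper faces lie in [Y], so it is an external face
    of [Y] that belongs to [X]. *)
Lemma core_eq X Y : Y \in Omega n r ->
  (core X == Y) = (Y \subset X) && [disjoint missing_faces Y & X].
Proof.
move=> YO; have YP := OmegaP YO; apply/eqP/andP => [XY|[YX dX]].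
  split; first by apply/fintype.subsetP => s; rewrite -XY => /mem_core.
  rewrite -finset.setI_eq0; apply/negPn/negP => /finset.set0Pn[s].
  rewrite !inE => /andP[/and4P[s0 sr sY bs] sX].
  move/negP: sY; apply; rewrite -XY inE s0 sr /=.
  rewrite -(finset.setD1K (below_self s0)) finset.subUset finset.sub1set sX /=.
  apply: fintype.subset_trans bs _.
  by apply/fintype.subsetP => t; rewrite -XY => /mem_core.
apply/eqP; rewrite finset.eqEsubset; apply/andP; split; last first.
  apply/fintype.subsetP => s sY; have [s0 sr bs] := YP _ sY.
  by rewrite inE s0 sr (fintype.subset_trans bs YX).
apply/fintype.subsetP => s; have [m] := ubnP #|s|; elim: m s => // m IH s sm sc.
apply: contraT => sY.
have : s \in missing_faces Y :&: X.
  rewrite !inE sY (mem_core sc) andbT; move: (sc); rewrite inE => /and3P[-> -> bs] /=.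
  apply/fintype.subsetP => t; rewrite !inE => /and3P[ts t0 tsub].
  apply: IH.
    apply: leq_trans (_ : #|t| < #|s|)%N _; last by [].
    by rewrite proper_card // finset.properEneq ts tsub.
  have /OmegaP := core_Omega X => /(_ _ sc)[_ _ /fintype.subsetP]; apply.
  by rewrite inE t0 tsub.
by rewrite (eqP (_ : missing_faces Y :&: X == finset.set0)) ?inE // finset.setI_eq0.
Qed.

Lemma ext_faces_missing i Y : (i <= r)%N ->
  ext_faces i Y = [set s in missing_faces Y | #|s| == i.+1].
Proof.
move=> ir; apply/finset.setP => s; rewrite !inE.
case: eqP => si; rewrite ?andbF //= andbT si ltnS ir /= -finset.card_gt0 si /=.
congr (_ && _); apply/forall_inP/fintype.subsetP => [H t|H t /andP[t0 ts]].
  rewrite !inE => /and3P[ts t0 tsub]; apply: H.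
  by rewrite t0 finset.properEneq ts.
by apply: H; rewrite !inE t0 (fintype.proper_sub ts) (finset.proper_neq ts).
Qed.

End Core.

Section Model.
Variables (R : realType) (n r : nat) (p : 'rV[R]_r.+1).
Local Notation S := {set 'I_n}.

(** The default value of [inord] makes this a number of [0, 1] even for the
    simplices of dimension above [r], which [core] discards. *)
Definition face_prob (s : S) : R := p 0 (inord #|s|.-1).

Lemma prod_by_dim (g : 'I_r.+1 -> R) (A : {set S}) :
    (forall s, s \in A -> s != finset.set0 /\ (#|s| <= r.+1)%N) ->
  \prod_(i < r.+1) g i ^+ #|[set s in A | #|s| == i.+1]%SET| =
    \prod_(s in A) g (inord #|s|.-1).
Proof.
move=> AP; rewrite (partition_big (fun s : S => inord #|s|.-1 : 'I_r.+1) predT) //=.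
apply: eq_bigr => i _; rewrite -prodr_const.
have e s : (s \in [set s in A | #|s| == i.+1]%SET) =
    (s \in A) && (inord #|s|.-1 == i :> 'I_r.+1).
  rewrite inE; case: (boolP (s \in A)) => //= /AP[s0 sr].
  rewrite -val_eqE /= inordK ?prednK //; last by rewrite finset.card_gt0.
  rewrite -finset.card_gt0 in s0; by case: #|s| s0.
by rewrite (eq_bigl _ _ e); apply: eq_bigr => s /andP[_ /eqP ->].
Qed.

(** The measure on complexes is the law of [core X]. *)
Lemma weight_core (Y : {set S}) : Y \in Omega n r ->
  weight p Y = \sum_(X : {set S} | core r X == Y) subset_weight face_prob X.
Proof.
move=> YO; have YP := OmegaP YO.
rewrite (eq_bigl _ _ (fun X => core_eq X YO)) sum_subset_weight_between; last first.
  rewrite -finset.setI_eq0; apply/eqP/finset.setP => s; rewrite !inE.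
  by case: (s \in Y); rewrite ?andbF.
have mP s : s \in missing_faces r Y -> s != finset.set0 /\ (#|s| <= r.+1)%N.
  by rewrite inE => /and4P[].
have YP' s : s \in Y -> s != finset.set0 /\ (#|s| <= r.+1)%N by case/YP.
rewrite /weight /face_prob -(prod_by_dim (p 0) YP').
rewrite -(prod_by_dim (fun i => 1 - p 0 i) mP); congr (_ * _).
by apply: eq_bigr => i _; rewrite (@ext_faces_missing _ r) // -ltnS.
Qed.

Lemma Pr_core (E : classical_sets.set {set S}) :
  Pr p E = Ex face_prob (fun X => `[< E (core r X) >]%:R).
Proof.
rewrite /Pr /Ex.
rewrite [RHS](partition_big (core r) (mem (Omega n r))) /=; last first.
  by move=> X _; exact: core_Omega.
rewrite big_mkcondr; apply: eq_bigr => Y YO; rewrite weight_core //.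
case: ifP => EY.
  by apply: eq_bigr => X /eqP ->; rewrite EY mulr1.
by rewrite big1 // => X /eqP ->; rewrite EY mulr0.
Qed.

Hypothesis p01 : forall i, 0 <= p 0 i <= 1.

Lemma Pr_le1 (E : classical_sets.set {set S}) : Pr p E <= 1.
Proof.
rewrite Pr_core -[leRHS](Ex1 face_prob); apply: Ex_le => [t|X]; first exact: p01.
by rewrite lern1 leq_b1.
Qed.

(** Markov's inequality: [g] dominates the indicator of failure. *)
Lemma Pr_ge (E : classical_sets.set {set S}) (g : {set S} -> R) :
    (forall X, 0 <= g X) -> (forall X, ~ E (core r X) -> 1 <= g X) ->
  1 - Ex face_prob g <= Pr p E.
Proof.
move=> g0 g1; rewrite Pr_core lerBlDr -[leLHS](Ex1 face_prob) -ExD.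
apply: Ex_le => [t|X]; first exact: p01.
by case: asboolP => [_|/g1]; [rewrite lerDl|rewrite add0r].
Qed.

End Model.

(** * Extending a simplex by a vertex *)

Section Block.
Variable n : nat.
Local Notation S := {set 'I_n}.
Implicit Types (s t : S) (v : 'I_n) (X Y : {set S}).

(** For [v \notin s] these are the simplices [v |: u] with [u \subset s]; for
    [v \in s] there are none.  In this form distinct vertices have disjoint
    blocks without any side condition. *)
Definition block s v : {set S} := [set t : S | t :\: s == [set v]].

Lemma block_disjoint s v w : v != w -> [disjoint block s v & block s w].
Proof.
move=> vw; rewrite -finset.setI_eq0; apply/eqP/finset.setP => t; rewrite !inE.
apply: contraNF vw => /andP[/eqP -> /eqP /finset.setP /(_ v)].
by rewrite !inE eqxx => /esym.
Qed.

Lemma block_notin s v t : v \notin s -> (t \in block s v) = (v \in t) && (t :\ v \subset s).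
Proof.
move=> vs; rewrite inE; apply/eqP/andP => [/finset.setP E|[vt ts]].
  have := E v; rewrite !inE eqxx => /andP[_ vt]; split=> //.
  apply/fintype.subsetP => w; rewrite !inE => /andP[wv wt].
  by apply: contraT => ws; have := E w; rewrite !inE wt ws (negbTE wv).
apply/finset.setP => w; rewrite !inE; case: eqVneq => [->|wv]; first by rewrite vs vt.
case: (boolP (w \in t)) => wt; rewrite ?andbF ?andbT //; apply/negbTE; rewrite negbK.
by apply: (fintype.subsetP ts); rewrite !inE wv.
Qed.

Lemma below_setU1 s v : v \notin s -> below (v |: s) = below s :|: block s v.
Proof.
move=> vs; apply/finset.setP => t; rewrite finset.in_setU block_notin // !inE.
rewrite -finset.subDset [t :\: [set v]]lock.
case: (boolP (v \in t)) => vt /=; rewrite -lock.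
  have -> : t != finset.set0 by apply/finset.set0Pn; exists v.
  have -> : (t \subset s) = false; last by [].
  by apply: contraNF vs => /fintype.subsetP; apply.
by rewrite orbF (finset.setDidPl _) // disjoint_sym disjoints1.
Qed.

Lemma below_block_disjoint s v : v \notin s -> [disjoint below s & block s v].
Proof.
move=> vs; rewrite -finset.setI_eq0; apply/eqP/finset.setP => t.
rewrite finset.in_setI block_notin // !inE; apply: contraNF vs.
by case/andP => /andP[_ /fintype.subsetP ts] /andP[/ts].
Qed.

Lemma prod_block (R : comPzRingType) s v (F : S -> R) : v \notin s ->
  \prod_(t in block s v) F t = \prod_(u : S | u \subset s) F (v |: u).
Proof.
move=> vs; rewrite (reindex_onto (fun u => v |: u) (fun t => t :\ v)) /=.
  apply: eq_bigl => u; rewrite block_notin // finset.setU11 /=.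
  have [vu|vu] := boolP (v \in u); last by rewrite finset.setU1K // eqxx andbT.
  have -> : (u \subset s) = false by apply: contraNF vs => /fintype.subsetP; apply.
  apply/negbTE; rewrite negb_and; apply/orP; right; apply/eqP.
  by move=> /finset.setP/(_ v); rewrite !inE vu eqxx.
by move=> t; rewrite block_notin // => /andP[vt _]; rewrite finset.setD1K.
Qed.

Definition extensions X s : S := [set v | (v \notin s) && (block s v \subset X)].

Lemma mem_core_setU1 r X s v : s \in core r X -> (#|s| <= r)%N -> v \notin s ->
  (v |: s \in core r X) = (block s v \subset X).
Proof.
rewrite !inE => /and3P[s0 _ bs] sr vs.
rewrite cardsU1 vs add1n ltnS sr below_setU1 // finset.subUset bs /=.
by case: eqP => // /finset.setP /(_ v); rewrite !inE eqxx.
Qed.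

(** The right-hand side makes sense for every [s], face or not, and depends on
    simplices other than those below [s]: this replaces conditioning on the
    event that [s] is a face. *)
Lemma deg_core r X s : s \in core r X -> (#|s| <= r)%N ->
  deg (core r X) s = #|extensions X s|.
Proof.
move=> sc sr; rewrite /deg -(@card_in_imset _ _ (fun v => v |: s) (mem (extensions X s))).
  apply: eq_card => t; rewrite inE; apply/and3P/imsetP => [[tc st /eqP ct]|[v]].
    have /cards1P[v tv] : #|t :\: s| == 1%N.
      by rewrite cardsD (finset.setIidPr st) ct subSnn.
    have vs : v \notin s by have := finset.set11 v; rewrite -tv inE => /andP[].
    have tE : t = v |: s by rewrite -tv finset.setUC -{1}(finset.setIidPr st) finset.setID.
    by exists v => //; rewrite inE vs -(mem_core_setU1 sc sr vs) -tE.
  rewrite inE => /andP[vs bv] ->; rewrite (mem_core_setU1 sc) // bv finset.subsetU1.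
  by rewrite cardsU1 vs.
move=> v w; rewrite !inE => /andP[vs _] /andP[ws _] /finset.setP /(_ v).
by rewrite !inE eqxx (negbTE vs) /= orbF => /esym/eqP.
Qed.

Lemma deg_Omega_top r Y s : Y \in Omega n r -> (r < #|s|)%N -> deg Y s = 0%N.
Proof.
move=> YO rs; apply: eq_card0 => t; rewrite inE; apply/negP => /and3P[tY _ /eqP ct].
by have [_] := OmegaP YO tY; rewrite ct ltnS leqNgt rs.
Qed.

End Block.

Section Probabilities.
Variables (R : realType) (n r : nat) (al : 'rV[R]_r.+1).
Hypothesis n0 : (0 < n)%N.
Local Notation S := {set 'I_n}.
Local Notation p := (\row_i (n%:R `^ (- al 0 i)) : 'rV[R]_r.+1).
Local Notation P := (@face_prob R n r p).

Let nR : 0 < n%:R :> R. Proof. by rewrite ltr0n. Qed.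

Lemma powRD_natr (x y : R) : n%:R `^ (x + y) = n%:R `^ x * n%:R `^ y.
Proof. by rewrite powRD // lt0r_neq0 ?implybT. Qed.

Lemma prod_powR (I : finType) (Q : pred I) (x : I -> R) :
  \prod_(i | Q i) n%:R `^ (x i) = n%:R `^ (\sum_(i | Q i) x i).
Proof. by rewrite (big_morph _ powRD_natr (powRr0 n%:R)). Qed.

Lemma face_prob_gt0 (s : S) : 0 < P s.
Proof. by rewrite /face_prob mxE powR_gt0. Qed.

Lemma face_prob_itv (al0 : nonneg al) i : 0 <= p 0 i <= 1.
Proof.
rewrite mxE powR_ge0 /= powRN invf_le1 ?powR_gt0 //.
by rewrite -[leLHS](powRr0 n%:R) ler_powR ?ler1n.
Qed.

Lemma prod_block_face_prob (s : S) v : v \notin s -> (#|s| <= r)%N ->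
  \prod_(t in block s v) P t = n%:R `^ (- psi #|s| al).
Proof.
move=> vs sr; rewrite prod_block //.
transitivity (\prod_(u : S | u \subset s) n%:R `^ (- al 0 (inord #|u|))).
  apply: eq_bigr => u us; rewrite /face_prob mxE cardsU1.
  by rewrite (contra (fintype.subsetP us v) vs).
rewrite prod_powR sumrN; congr (_ `^ - _).
rewrite (partition_big (fun u : S => inord #|u| : 'I_r.+1) predT) //=.
apply: eq_bigr => i _; rewrite -(cards_draws s) mulr_natl -sumr_const.
apply: eq_big => [u|u /andP[_ /eqP ->] //].
rewrite inE; case: (boolP (u \subset s)) => //= us.
by rewrite -val_eqE /= inordK // ltnS (leq_trans (subset_leq_card us)).
Qed.

(** Adding a vertex to a simplex with [j] vertices adds one block, hence a factor
    n^(- psi_j). *)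
Lemma prod_below_face_prob (s : S) : (#|s| <= r.+1)%N ->
  \prod_(t in below s) P t = n%:R `^ (- \sum_(i < #|s|) psi i al).
Proof.
have [m] := ubnP #|s|; elim: m s => // m IH s.
have [->|/finset.set0Pn[v vs]] := eqVneq s finset.set0.
  move=> _ _; rewrite cards0 big_ord0 oppr0 powRr0 big_pred0 // => t.
  by rewrite inE finset.subset0 andNb.
move: (finset.setD1K vs) (finset.setD11 v s); set s' := s :\ v => <- /negbT vs'.
rewrite cardsU1 vs' add1n !ltnS => sm sr.
rewrite (eq_bigl [in [predU below s' & block s' v]]); last first.
  by move=> t; rewrite below_setU1 // !inE.
rewrite bigU /=; last exact: below_block_disjoint.
by rewrite IH ?leqW // prod_block_face_prob // big_ord_recr opprD powRD_natr.
Qed.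

(** Up to a constant factor, this is the expected number of [j]-faces. *)
Lemma powR_tau j : n%:R ^+ j.+1 * n%:R `^ (- \sum_(i < j.+1) psi i al) = n%:R `^ (tau j al).
Proof.
have -> : tau j al = j.+1%:R + - \sum_(i < j.+1) psi i al.
  by rewrite /tau big_split /= sumr_const card_ord sumrN.
by rewrite powRD_natr powR_mulrn // ler0n.
Qed.

(** The generating function of a binomial variable. *)
Lemma Ex_exp_extensions (s : S) (c : R) : (#|s| <= r)%N ->
  Ex P (fun X => (1 + c) ^+ #|extensions X s|) =
    (1 + c * n%:R `^ (- psi #|s| al)) ^+ (n - #|s|).
Proof.
move=> sr.
(* The blocks of the vertices of [s] are empty, so their factor must be trivial. *)
pose c' v := if v \in s then 0 else c.
transitivity (Ex P (fun X => \prod_v (1 + c' v * (block s v \subset X)%:R))).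
  apply: eq_Ex => X; rewrite -prodr_const big_mkcond; apply: eq_bigr => v _.
  rewrite inE /c'; case: (v \in s); first by rewrite mul0r addr0.
  by case: (block s v \subset X); rewrite /= ?mulr1 ?mulr0 ?addr0.
rewrite Ex_prod_blocks; last exact: block_disjoint.
have -> : (n - #|s|)%N = #|~: s| by rewrite [RHS]cardsCs finset.setCK card_ord.
rewrite -prodr_const [RHS]big_mkcond; apply: eq_bigr => v _.
rewrite inE /c'; case: (boolP (v \in s)) => vs; first by rewrite mul0r addr0.
by rewrite prod_block_face_prob.
Qed.

End Probabilities.

(** * Large deviations of the degrees *)

Section Chernoff.
Variable R : realType.

(** The rate function of the Poisson law of mean 1 at [1 + c]. *)
Definition cramer_rate (c : R) : R := (1 + c) * ln (1 + c) - c.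

(** The strict inequality 1 + x < exp x at x = - ln (1 + c). *)
Lemma cramer_rate_gt0 (c : R) : -1 < c -> c != 0 -> 0 < cramer_rate c.
Proof.
move=> c1 c0; have y0 : 0 < 1 + c by lra.
have : 1 + - ln (1 + c) < expR (- ln (1 + c)).
  apply: expR_gt1Dx; rewrite oppr_eq0 ln_eq0 //.
  by apply: contraNneq c0 => e; apply/eqP; lra.
rewrite expRN lnK ?posrE // -(ltr_pM2l y0) mulfV ?gt_eqF // /cramer_rate; lra.
Qed.

Lemma bin_le_exp n k : ('C(n, k) <= n ^ k)%N.
Proof.
apply: leq_trans (_ : n ^_ k <= _)%N.
  by rewrite -bin_ffact leq_pmulr ?fact_gt0.
have -> : (n ^ k = \prod_(i < k) n)%N by rewrite prod_nat_const card_ord.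
by rewrite ffact_prod; apply: leq_prod => i _; exact: leq_subr.
Qed.

Variables (n r : nat) (al : 'rV[R]_r.+1).
Hypotheses (n0 : (0 < n)%N) (al0 : nonneg al).
Local Notation p := (\row_i (n%:R `^ (- al 0 i)) : 'rV[R]_r.+1).
Local Notation P := (@face_prob R n r p).

Let nR : 0 < n%:R :> R. Proof. by rewrite ltr0n. Qed.

Lemma psi_ge0 k : 0 <= psi k al.
Proof. by apply: sumr_ge0 => i _; rewrite mulr_ge0 ?ler0n. Qed.

Lemma powRN_le1 (x : R) : 0 <= x -> n%:R `^ (- x) <= 1.
Proof.
move=> x0; rewrite -[leRHS](powRr0 n%:R) ler_powR ?ler1n //; lra.
Qed.

Lemma muE d : mu n d al = n%:R * n%:R `^ (- psi d.+1 al).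
Proof. by rewrite /mu powRD_natr // powRr1 // ltW. Qed.

(** The exponential moment used to control deviations of the degree of [s] above
    [(1 + c) * mu] when [c > 0], and below it when [c < 0]. *)
Definition tilt d (c : R) (s : {set 'I_n}) (X : {set {set 'I_n}}) : R :=
  (1 + c) ^+ #|extensions X s| * expR (- ((1 + c) * ln (1 + c) * mu n d al)).

Lemma tilt_ge0 d (c : R) s X : -1 < c -> 0 <= tilt d c s X.
Proof.
move=> c1; have y0 : 0 <= 1 + c by lra.
by rewrite mulr_ge0 ?exprn_ge0 // expR_ge0.
Qed.

(** The first factor pays for the [d.+1] vertices of [s], which are not available
    to extend it: the binomial has [n - d.+1] trials rather than [n]. *)
Lemma Ex_tilt_le d (c : R) (s : {set 'I_n}) : -1 < c -> #|s| = d.+1 -> (d < r)%N ->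
  Ex P (tilt d c s) <= expR (`|c| * d.+1%:R) * expR (- (cramer_rate c * mu n d al)).
Proof.
move=> c1 sd dr.
rewrite /tilt (@eq_Ex _ _ P _ (fun X => expR (- ((1 + c) * ln (1 + c) * mu n d al)) *
  (1 + c) ^+ #|extensions X s|)); last by move=> X; rewrite mulrC.
rewrite ExZ Ex_exp_extensions // ?sd //.
set q := n%:R `^ _.
have q0 : 0 <= q by exact: powR_ge0.
have q1 : q <= 1 by exact/powRN_le1/psi_ge0.
have : (1 + c * q) ^+ (n - d.+1) <= expR (c * q * (n - d.+1)%:R).
  rewrite expRM_natr lerXn2r ?nnegrE ?expR_ge0 ?expR_ge1Dx //.
  have : - q <= c * q by rewrite -mulN1r ler_wpM2r // ltW.
  lra.
move=> H; apply: (le_trans (ler_wpM2l (expR_ge0 _) H)).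
rewrite -!expRD ler_expR muE -/q /cramer_rate.
set x := ((n - d.+1)%:R : R).
have : c * q * (x - n%:R) <= `|c| * d.+1%:R.
  have xn : n%:R - x = (minn n d.+1)%:R :> R.
    by rewrite /x -natrB ?leq_subr // minnE.
  apply: le_trans (ler_norm _) _; rewrite !normrM -mulrA ler_wpM2l //.
  rewrite (ger0_norm q0) distrC xn normr_nat.
  rewrite -[leRHS]mul1r ler_pM // ?ler_nat ?geq_minr //.
lra.
Qed.

Lemma tilt_ge1 d (c : R) (s : {set 'I_n}) (X : {set {set 'I_n}}) :
    -1 < c -> 0 <= ln (1 + c) * (#|extensions X s|%:R - (1 + c) * mu n d al) ->
  1 <= tilt d c s X.
Proof.
move=> c1 H; rewrite /tilt -{1}(@lnK _ (1 + c)); last by rewrite posrE; lra.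
rewrite -expRM_natr -expRD -[leLHS]expR0 ler_expR; lra.
Qed.

Variables (d : nat) (delta : R).
Hypotheses (dr : (d < r)%N) (delta01 : 0 < delta < 1).

(** Union bound over all simplices with [d.+1] vertices, using [tilt] at [delta]
    against degrees that are too large and at [- delta] against degrees that
    are too small. *)
Lemma Pr_all_degrees_ge (E : classical_sets.set {set {set 'I_n}}) :
    (forall Y, (forall x, x \in faces d Y ->
       `|(deg Y x)%:R - mu n d al| <= delta * mu n d al) -> E Y) ->
  1 - n%:R ^+ d.+1 * expR (delta * d.+1%:R) *
     (expR (- (cramer_rate delta * mu n d al)) +
      expR (- (cramer_rate (- delta) * mu n d al))) <= Pr p E.
Proof.
move=> EP; case/andP: delta01 => d0 d1.
pose g X := \sum_(s : {set 'I_n} | #|s| == d.+1) (tilt d delta s X + tilt d (- delta) s X).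
apply: le_trans (@Pr_ge _ _ _ _ (face_prob_itv n0 al0) E g _ _); last 2 first.
- move=> X; apply: sumr_ge0 => s _; rewrite addr_ge0 // tilt_ge0 //; lra.
- move=> X nE; have [x xf xbad] : exists2 x, x \in faces d (core r X) &
      ~~ (`|(deg (core r X) x)%:R - mu n d al| <= delta * mu n d al).
    apply/exists_inP; apply: contrapT => /negP; rewrite negb_exists_in => /forall_inP H.
    by apply: nE; apply: EP => x /H; rewrite negbK.
  move: xf; rewrite inE => /andP[xc xd].
  rewrite /g (bigD1 x) //= -[leLHS]addr0 lerD //; last first.
    apply: sumr_ge0 => s _; rewrite addr_ge0 // tilt_ge0 //; lra.
  move: xbad; rewrite deg_core ?(eqP xd) // -ltNge.
  rewrite ltr_normr => /orP[big|small].
  + rewrite -[leLHS]addr0 lerD ?tilt_ge0 //; last lra.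
    apply: tilt_ge1; first lra.
    by apply: mulr_ge0; [apply: ln_ge0|]; lra.
  + rewrite -[leLHS]add0r lerD ?tilt_ge0 //; first lra.
    apply: tilt_ge1; first lra.
    rewrite -mulrNN mulr_ge0 // oppr_ge0; last lra.
    by apply: ln_le0; lra.
rewrite lerD2l lerN2 Ex_sum.
apply: (@le_trans _ _ (\sum_(s : {set 'I_n} | #|s| == d.+1) expR (delta * d.+1%:R) *
     (expR (- (cramer_rate delta * mu n d al)) +
      expR (- (cramer_rate (- delta) * mu n d al))))).
  apply: ler_sum => s /eqP sd; rewrite ExD mulrDr.
  apply: lerD; [have := @Ex_tilt_le d delta s|have := @Ex_tilt_le d (- delta) s];
    rewrite ?normrN (gtr0_norm d0); apply => //; lra.
rewrite sumr_const -cardsE card_draws card_ord -mulrA -[leLHS]mulr_natl.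
rewrite ler_wpM2r ?mulr_ge0 ?addr_ge0 ?expR_ge0 //.
by rewrite -natrX ler_nat bin_le_exp.
Qed.

End Chernoff.

(** * Second moment of the number of faces *)

Lemma prod_setUI (R : comPzRingType) (T : finType) (A B : {set T}) (F : T -> R) :
  (\prod_(t in A :|: B) F t) * (\prod_(t in A :&: B) F t) =
    (\prod_(t in A) F t) * \prod_(t in B) F t.
Proof.
rewrite (big_mkcond (mem (A :|: B))) (big_mkcond (mem (A :&: B))).
rewrite (big_mkcond (mem A)) (big_mkcond (mem B)).
rewrite -!big_split; apply: eq_bigr => t _ /=.
by rewrite !inE; case: (t \in A); case: (t \in B); rewrite /= ?(mulr1, mul1r).
Qed.

Lemma below_setI n (s t : {set 'I_n}) : below s :&: below t = below (s :&: t).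
Proof.
by apply/finset.setP => u; rewrite !inE finset.subsetI; case: (u != _).
Qed.

Lemma card_supsets_le (T : finType) (A : {set T}) m :
  (#|[set B : {set T} | (A \subset B) && (#|B| == m)]%SET| <= 'C(#|T| - #|A|, m - #|A|))%N.
Proof.
have -> : (#|T| - #|A|)%N = #|~: A| by rewrite [RHS]cardsCs finset.setCK.
rewrite -cards_draws -(@card_in_imset _ _ (fun B : {set T} => B :\: A)).
  apply: subset_leq_card; apply/fintype.subsetP => C /imsetP[B].
  rewrite inE => /andP[AB /eqP Bm] ->; rewrite inE.
  rewrite cardsD (finset.setIidPr AB) Bm eqxx andbT.
  by rewrite finset.setDE finset.subsetIr.
move=> B C; rewrite !inE => /andP[/finset.setIidPr AB _] /andP[/finset.setIidPr AC _] E.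
by rewrite -(finset.setID B A) E AB -{1}AC finset.setID.
Qed.

(** A set of [m] points among [n] contains [j] given points with probability at
    most (m/n)^j. *)
Lemma bin_ratio n m j : (j <= m)%N -> (m <= n)%N ->
  ('C(n - j, m - j) * n ^ j <= m ^ j * 'C(n, m))%N.
Proof.
elim: j => [|j IH] jm mn; first by rewrite !subn0 muln1 mul1n.
have {}IH := IH (ltnW jm) mn.
have D := mul_bin_diag (n - j) (m - j).-1.
rewrite prednK ?subn_gt0 // -!subnS in D.
have H : (n * 'C(n - j.+1, m - j.+1) <= m * 'C(n - j, m - j))%N.
  have nj : (0 < n - j)%N by rewrite subn_gt0 (leq_trans jm).
  rewrite -(leq_pmul2l nj).
  rewrite mulnCA D !mulnA leq_mul2r; apply/orP; right; nia.
rewrite !expnS mulnCA mulnA.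
apply: leq_trans (leq_mul H (leqnn _)) _.
by rewrite -!mulnA leq_mul2l IH orbT.
Qed.

Section SecondMoment.
Variables (R : realType) (n r : nat) (al : 'rV[R]_r.+1).
Hypotheses (n0 : (0 < n)%N) (al0 : nonneg al).
Local Notation S := {set 'I_n}.
Local Notation p := (\row_i (n%:R `^ (- al 0 i)) : 'rV[R]_r.+1).
Local Notation P := (@face_prob R n r p).
Variable d : nat.
Hypothesis dr : (d <= r)%N.

Let nR : 0 < n%:R :> R. Proof. by rewrite ltr0n. Qed.

Definition face_count (X : {set S}) : R :=
  \sum_(s : S | #|s| == d.+1) (below s \subset X)%:R.

Definition mean_faces : R := 'C(n, d.+1)%:R * n%:R `^ (- \sum_(i < d.+1) psi i al).

(** The relative variance of the number of [d]-faces is at most this quantity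
    when all tau_j with [j <= d] are at least [c]: a pair of simplices shares
    one of the 2^(d+1) subsets of the first, and each subset costs at most
    (d+1)^(d+1) n^(- c). *)
Definition variance_bound (c : R) : R := (2 * d.+1)%:R ^+ d.+1 * n%:R `^ (- c).

Lemma face_countE X : #|faces d (core r X)|%:R = face_count X.
Proof.
rewrite /face_count -natr_sum -sum1_card big_mkcond [in RHS]big_mkcond; congr (_%:R).
apply: eq_bigr => s _; rewrite !inE; case: (boolP (#|s| == d.+1)) => sd; rewrite ?andbF //.
by rewrite (eqP sd) ltnS dr -finset.card_gt0 (eqP sd) andbT; case: (below s \subset X).
Qed.

Lemma Ex_face_count : Ex P face_count = mean_faces.
Proof.
rewrite /face_count Ex_sum.
rewrite (eq_bigr (fun=> n%:R `^ (- \sum_(i < d.+1) psi i al))).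
  by rewrite sumr_const -cardsE card_draws card_ord -[LHS]mulr_natl.
by move=> s /eqP sd; rewrite Ex_supset prod_below_face_prob // sd.
Qed.

(** Simplices below both [s] and [t] are required only once, which explains the
    correction by the probability of the common face. *)
Lemma Ex_pair (s t : S) : #|s| = d.+1 -> #|t| = d.+1 ->
  Ex P (fun X => (below s \subset X)%:R * (below t \subset X)%:R) =
    n%:R `^ (- \sum_(i < d.+1) psi i al) ^+ 2 *
      n%:R `^ (\sum_(i < #|s :&: t|) psi i al).
Proof.
move=> sd td.
rewrite (@eq_Ex _ _ P _ (fun X => (below s :|: below t \subset X)%:R)); last first.
  by move=> X; rewrite finset.subUset -natrM mulnb.
rewrite Ex_supset.
have I0 : 0 < \prod_(u in below s :&: below t) P u.
  by apply: prodr_gt0 => u _; exact: face_prob_gt0.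
apply: (mulIf (lt0r_neq0 I0)).
rewrite prod_setUI below_setI !prod_below_face_prob // ?sd ?td //; last first.
  by rewrite (leq_trans (subset_leq_card (subsetIl s t))) // sd.
by rewrite -[RHS]mulrA -[X in _ = _ * X]powRD_natr // subrr powRr0 mulr1 expr2.
Qed.

(** The sum over [t] is organised by the intersection [A] of [s] and [t].  The
    empty intersection gives the main term; for [j = #|A| > 0] the number of
    [t] is smaller by a factor (d+1)^j n^(- j), and n^(- j) times the
    correction is n^(- tau_(j-1)). *)
Lemma sum_overlap_le (c : R) (s : S) : #|s| = d.+1 ->
    (forall j, (j <= d)%N -> c <= tau j al) ->
  \sum_(t : S | #|t| == d.+1) n%:R `^ (\sum_(i < #|s :&: t|) psi i al) <=
    'C(n, d.+1)%:R * (1 + variance_bound c).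
Proof.
move=> sd tauc.
have dn : (d.+1 <= n)%N by rewrite -sd -[leqRHS]card_ord max_card.
rewrite (partition_big (fun t => s :&: t) (fun A : S => A \subset s)) /=; last first.
  by move=> t _; exact: subsetIl.
pose w (A : S) : R := n%:R `^ (\sum_(i < #|A|) psi i al) *
  ((d.+1)%:R ^+ #|A| / n%:R ^+ #|A|).
have step (A : S) : A \subset s ->
  \sum_(t : S | (#|t| == d.+1) && (s :&: t == A)) n%:R `^ (\sum_(i < #|s :&: t|) psi i al)
    <= 'C(n, d.+1)%:R * w A.
  move=> As.
  rewrite (eq_bigr (fun=> n%:R `^ (\sum_(i < #|A|) psi i al))); last first.
    by move=> t /andP[_ /eqP ->].
  rewrite sumr_const -[leLHS]mulr_natl /w mulrCA [leRHS]mulrC ler_wpM2r ?powR_ge0 //.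
  rewrite mulrA ler_pdivlMr ?exprn_gt0 // -!natrX -!natrM ler_nat.
  have Ad : (#|A| <= d.+1)%N by rewrite -sd subset_leq_card.
  rewrite [leqRHS]mulnC; apply: leq_trans (bin_ratio Ad dn).
  rewrite leq_mul2r; apply/orP; right.
  have := card_supsets_le A d.+1; rewrite card_ord; apply: leq_trans.
  rewrite -cardsE; apply: subset_leq_card; apply/fintype.subsetP => t.
  by rewrite !inE => /andP[-> /eqP <-]; rewrite subsetIr.
apply: le_trans (ler_sum _ step) _.
rewrite -mulr_sumr ler_wpM2l ?ler0n //.
rewrite (bigD1 finset.set0) ?finset.sub0set //= lerD //.
  by rewrite /w cards0 big_ord0 powRr0 !expr0 divr1 mulr1.
have wle (A : S) : (A \subset s) && (A != finset.set0) ->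
    w A <= d.+1%:R ^+ d.+1 * n%:R `^ (- c).
  move=> /andP[As]; rewrite -finset.card_gt0 /w => A0.
  have Ad : (#|A| <= d.+1)%N by rewrite -sd subset_leq_card.
  rewrite mulrCA; apply: ler_pM.
  - by rewrite exprn_ge0 ?ler0n.
  - by rewrite mulr_ge0 ?powR_ge0 // invr_ge0 exprn_ge0 // ler0n.
  - by rewrite ler_weXn2l // ler1n.
  have tA : c <= tau #|A|.-1 al by apply: tauc; rewrite -ltnS prednK.
  have : (n%:R `^ (tau #|A|.-1 al))^-1 <= n%:R `^ (- c).
    by rewrite -powRN ler_powR ?ler1n // lerN2.
  apply: le_trans; rewrite -(powR_tau al n0) prednK // powRN invfM invrK mulrC //.
apply: le_trans (ler_sum _ wle) _.
rewrite sumr_const /variance_bound natrM exprMn -[leLHS]mulr_natl mulrA.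
rewrite ler_wpM2r ?powR_ge0 // ler_wpM2r ?exprn_ge0 ?ler0n //.
rewrite -natrX ler_nat -sd -card_powerset; apply: subset_leq_card.
by apply/fintype.subsetP => A; rewrite unfold_in inE => /andP[].
Qed.

Lemma Ex_face_count_sqr_le (c : R) : (forall j, (j <= d)%N -> c <= tau j al) ->
  Ex P (fun X => face_count X ^+ 2) <= mean_faces ^+ 2 * (1 + variance_bound c).
Proof.
move=> tauc.
rewrite (@eq_Ex _ _ P _ (fun X => \sum_(s : S | #|s| == d.+1) \sum_(t : S | #|t| == d.+1)
    (below s \subset X)%:R * (below t \subset X)%:R)); last first.
  by move=> X; rewrite expr2 mulr_suml; apply: eq_bigr => s _; rewrite mulr_sumr.
rewrite Ex_sum.
set q := n%:R `^ (- \sum_(i < d.+1) psi i al).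
apply: (@le_trans _ _ (\sum_(s : S | #|s| == d.+1)
    q ^+ 2 * ('C(n, d.+1)%:R * (1 + variance_bound c)))).
  apply: ler_sum => s /eqP sd; rewrite Ex_sum.
  apply: le_trans (ler_wpM2l _ (sum_overlap_le sd tauc)); last first.
    by rewrite exprn_ge0 ?powR_ge0.
  by rewrite mulr_sumr; apply: ler_sum => t /eqP td; rewrite Ex_pair.
rewrite sumr_const -cardsE card_draws card_ord -[leLHS]mulr_natl /mean_faces -/q.
by rewrite le_eqVlt; apply/orP; left; apply/eqP; ring.
Qed.

Definition covered_faces (Y : {set S}) : {set S} :=
  [set x in faces d Y | deg Y x != 0%N]%SET.

Lemma Ex_covered_faces_top : (d = r) -> Ex P (fun X => #|covered_faces (core r X)|%:R) = 0.
Proof.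
move=> dE; rewrite /Ex big1 // => X _.
rewrite (_ : #|_| = 0%N) ?mulr0 //; apply: eq_card0 => s; rewrite !inE.
case: (boolP (#|s| == d.+1)) => sd; rewrite ?andbF //=.
by rewrite (@deg_Omega_top _ r) ?core_Omega ?eqxx ?andbF // (eqP sd) dE.
Qed.

(** Faces of positive degree are counted by pairs of a face and a vertex
    extending it. *)
Lemma Ex_covered_faces_le : (d < r)%N ->
  Ex P (fun X => #|covered_faces (core r X)|%:R) <= mean_faces * n%:R `^ (1 - psi d.+1 al).
Proof.
move=> d_lt_r.
apply: (@le_trans _ _ (Ex P (fun X => \sum_(s : S | #|s| == d.+1) \sum_(v | v \notin s)
    (below (v |: s) \subset X)%:R))).
  apply: Ex_le => [t|X]; first exact: face_prob_itv.
  rewrite -sum1_card natr_sum big_mkcond [leRHS]big_mkcond; apply: ler_sum => s _.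
  case: ifP => [|_]; last by case: ifP => // _; apply: sumr_ge0 => v _; rewrite ler0n.
  rewrite !inE -andbA => /and3P[sc sd]; rewrite sd.
  have sr : (#|s| <= r)%N by rewrite (eqP sd).
  have sc' : s \in core r X by rewrite inE.
  rewrite (deg_core sc' sr) -lt0n finset.card_gt0 => /finset.set0Pn[v].
  rewrite inE => /andP[vs bv]; rewrite (bigD1 v) //= below_setU1 // finset.subUset bv andbT.
  case/and3P: sc => _ _ ->; rewrite lerDl.
  by apply: sumr_ge0 => w _; rewrite ler0n.
rewrite Ex_sum.
set q := n%:R `^ (- \sum_(i < d.+1) psi i al).
apply: (@le_trans _ _ (\sum_(s : S | #|s| == d.+1) q * n%:R `^ (1 - psi d.+1 al))).
  apply: ler_sum => s /eqP sd; rewrite Ex_sum.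
  rewrite (eq_bigr (fun=> q * n%:R `^ (- psi d.+1 al))); last first.
    move=> v vs; rewrite Ex_supset prod_below_face_prob // ?cardsU1 ?vs ?sd //.
    by rewrite big_ord_recr opprD powRD_natr.
  rewrite sumr_const -[leLHS]mulr_natl powRD_natr // powRr1 ?ler0n // [leRHS]mulrCA.
  rewrite ler_wpM2r ?mulr_ge0 ?powR_ge0 // ler_nat.
  by rewrite -[leqRHS]card_ord max_card.
by rewrite sumr_const -cardsE card_draws card_ord -[leLHS]mulr_natl mulrA.
Qed.

(** Chebyshev's inequality makes the number of faces exceed half its mean [M],
    and Markov's inequality keeps the number of covered faces below
    [sqrt eps * M]; the proportion is then below [2 * sqrt eps]. *)
Lemma Pr_most_faces_isolated_ge (E : classical_sets.set {set S}) (c eps : R) :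
    (d < n)%N -> 0 < eps -> (forall j, (j <= d)%N -> c <= tau j al) ->
    Ex P (fun X => #|covered_faces (core r X)|%:R) <= mean_faces * eps ->
    (forall Y, (0 < #|faces d Y|)%N /\
       1 - 2 * Num.sqrt eps < #|faces_deg d 0 Y|%:R / #|faces d Y|%:R -> E Y) ->
  1 - (4 * variance_bound c + Num.sqrt eps) <= Pr p E.
Proof.
move=> dn eps0 tauc coveredle EP.
have M0 : 0 < mean_faces by rewrite mulr_gt0 ?powR_gt0 // ltr0n bin_gt0.
set M := mean_faces in M0 coveredle *.
set e := Num.sqrt eps; have e0 : 0 < e by rewrite sqrtr_gt0.
have ee : e ^+ 2 = eps by rewrite sqr_sqrtr // ltW.
pose W X : R := #|covered_faces (core r X)|%:R.
pose g X := 4 / M ^+ 2 * (face_count X - M) ^+ 2 + (e * M)^-1 * W X.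
have sq X : 0 <= 4 / M ^+ 2 * (face_count X - M) ^+ 2.
  by rewrite mulr_ge0 ?sqr_ge0 // divr_ge0 ?sqr_ge0.
have Wg X : 0 <= (e * M)^-1 * W X.
  by rewrite mulr_ge0 ?ler0n // invr_ge0 mulr_ge0 // ltW.
apply: le_trans (@Pr_ge _ _ _ _ (face_prob_itv n0 al0) E g _ _).
- rewrite lerD2l lerN2 ExD !ExZ; apply: lerD.
    rewrite /M -Ex_face_count Ex_sqr_dist Ex_face_count -/M.
    rewrite -mulrA ler_pM2l // ler_pdivrMl ?exprn_gt0 // lerBlDl.
    by apply: le_trans (Ex_face_count_sqr_le tauc) _; rewrite -/M mulrDr mulr1.
  rewrite ler_pdivrMl; last exact: mulr_gt0.
  apply: (le_trans coveredle).
  by rewrite -ee expr2 mulrA [e * M]mulrC.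
- by move=> X; rewrite addr_ge0.
move=> X nE; rewrite /g.
have [small|big] := leP (face_count X) (M / 2).
  rewrite -[leLHS]addr0 lerD //.
  rewrite mulrAC ler_pdivlMr ?exprn_gt0 // mul1r.
  (* This product is [(face_count X - M)^2 - M^2 / 4]. *)
  have : 0 <= (M / 2 - face_count X) * (3 / 2 * M - face_count X).
    by apply: mulr_ge0; lra.
  by move=> H; lra.
have eM0 : 0 < e * M by exact: mulr_gt0.
suff : 1 <= (e * M)^-1 * W X by move=> H; rewrite -[leLHS]add0r lerD.
rewrite ler_pdivlMl // mulr1.
set Y := core r X.
have NE : #|faces d Y|%:R = face_count X := face_countE X.
have N0 : 0 < #|faces d Y|%:R :> R by rewrite NE; lra.
have split : #|faces d Y|%:R = #|faces_deg d 0 Y|%:R + W X.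
  rewrite -natrD -(cardsID [set x | deg Y x == 0%N]%SET (faces d Y)).
  congr ((_ + _)%:R); apply: eq_card => x; rewrite !inE //.
  by rewrite andbC.
have [//|lt] := leP (e * M) (W X).
exfalso; apply: nE; apply: EP; split; first by rewrite ltr0n in N0.
rewrite ltr_pdivlMr // split -/e.
have : e * (M / 2) < e * (#|faces_deg d 0 Y|%:R + W X).
  by rewrite ltr_pM2l // -split NE.
lra.
Qed.

End SecondMoment.

(** * Asymptotics *)

Section Exponents.
Variables (R : realType) (r : nat).
Implicit Types b : 'rV[R]_r.+1.

Lemma le_psi b j k : nonneg b -> (j <= k)%N -> psi j b <= psi k b.
Proof.
move=> b0 jk; apply: ler_sum => i _; apply: ler_wpM2r; first exact: b0.
by rewrite ler_nat leq_bin2l.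
Qed.

Lemma tauS j b : tau j.+1 b = tau j b + (1 - psi j.+1 b).
Proof. by rewrite /tau big_ord_recr. Qed.

Lemma tau_le_psi0 d b : nonneg b -> tau d b <= d.+1%:R * (1 - psi 0 b).
Proof.
move=> b0; apply: (@le_trans _ _ (\sum_(i < d.+1) (1 - psi 0 b))).
  by apply: ler_sum => i _; rewrite lerD2l lerN2 le_psi.
by rewrite sumr_const card_ord mulr_natl.
Qed.

(** Concavity of [j |-> tau j b]: its increments [1 - psi j b] do not increase,
    so up to the index where they become negative tau_j is at least its first
    increment, and from there on it is at least tau_d. *)
Lemma le_tau_min (c : R) b d j : nonneg b -> (j <= d)%N ->
  0 <= c -> c <= 1 - psi 0 b -> c <= tau d b -> c <= tau j b.
Proof.
move=> b0 jd c0 cpsi ctau.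
have [psi1|psi1] := leP (psi j b) 1.
  apply: (le_trans cpsi); rewrite /tau big_ord_recl /= lerDl.
  apply: sumr_ge0 => i _; rewrite subr_ge0; apply: le_trans psi1.
  by apply: le_psi => //; have := ltn_ord i; rewrite /bump add1n.
apply: (le_trans ctau).
elim: d jd {ctau} => [|d IH]; first by rewrite leqn0 => /eqP ->.
rewrite leq_eqVlt => /predU1P[-> //|jd]; apply: le_trans (IH jd).
have := le_psi b0 (ltnW jd); rewrite tauS; lra.
Qed.

Lemma cvg_psi (a : nat -> 'rV[R]_r.+1) astar k :
  (a @ \oo --> astar)%classic -> ((fun n => psi k (a n)) @ \oo --> psi k astar)%classic.
Proof.
move=> acvg; apply: cvg_big => [|i _]; first exact: add_continuous.
apply: cvgMl_tmp.
exact: (continuous_cvg _ (@coord_continuous R 1 r.+1 0 i astar) acvg).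
Qed.

Lemma cvg_tau (a : nat -> 'rV[R]_r.+1) astar k :
  (a @ \oo --> astar)%classic -> ((fun n => tau k (a n)) @ \oo --> tau k astar)%classic.
Proof.
move=> acvg; apply: cvg_big => [|i _]; first exact: add_continuous.
by apply: cvgB; [exact: cvg_cst|exact: cvg_psi].
Qed.

End Exponents.

Section Asymptotics.
Variable R : realType.

Lemma cvg_powRN0 (c : R) : 0 < c ->
  ((fun n : nat => n%:R `^ (- c)) @ \oo --> (0 : R))%classic.
Proof.
move=> c0; apply/cvgr0Pnorm_lt => e e0.
near=> n.
have n0 : (0 < n)%N by near: n; exact: nbhs_infty_gt.
have big : e `^ (- c^-1) < n%:R :> R by near: n; exact: nbhs_infty_gtr.
rewrite ger0_norm ?powR_ge0 // powRN invf_plt ?posrE ?powR_gt0 ?ltr0n //.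
have := gt0_ltr_powR c0 _ _ big; rewrite !nnegrE powR_ge0 ler0n => /(_ isT isT).
rewrite -powRrM mulNr mulVf ?gt_eqF // powR_inv1 //; exact: ltW.
Unshelve. all: by end_near.
Qed.

(** The exponential dominates the power [M.+1], where [M] is chosen so that
    [u n ^+ M.+1] is at least [n ^+ m.+1]. *)
Lemma cvg_poly_expR0 (kappa c0 : R) (m : nat) (u : nat -> R) :
    0 < kappa -> 0 < c0 -> (\forall n \near \oo%classic, n%:R `^ c0 <= u n) ->
  ((fun n : nat => n%:R ^+ m * expR (- (kappa * u n))) @ \oo --> (0 : R))%classic.
Proof.
move=> k0 c00 un.
pose M := Num.bound (m.+1%:R / c0).
have cM : m.+1%:R <= c0 * M.+1%:R.
  rewrite mulrC -ler_pdivrMr //; apply: ltW.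
  apply: lt_le_trans (archi_boundP _) _; first by rewrite divr_ge0 ?ler0n // ltW.
  by rewrite ler_nat.
pose C : R := (M.+1)`!%:R / kappa ^+ M.+1.
apply: (@squeeze_cvgr _ _ _ _ (fun=> 0) (fun n : nat => C * n%:R `^ (- 1))).
- near=> n.
  have n0 : 0 < n%:R :> R by rewrite ltr0n; near: n; exact: nbhs_infty_gt.
  have lu : n%:R `^ c0 <= u n by near: n.
  rewrite mulr_ge0 ?exprn_ge0 ?expR_ge0 ?ler0n //=.
  have n1 : 1 <= n%:R :> R by rewrite ler1n -(ltr0n R).
  have u0 : 0 < u n by apply: lt_le_trans lu; exact: powR_gt0.
  have ku0 : 0 < kappa * u n by exact: mulr_gt0.
  have big : n%:R ^+ m.+1 <= u n ^+ M.+1.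
    apply: (@le_trans _ _ ((n%:R `^ c0) ^+ M.+1)).
      by rewrite -!powR_mulrn ?powR_ge0 ?ler0n // -powRrM ler_powR.
    by rewrite lerXn2r ?nnegrE ?powR_ge0 // ltW.
  have ex : (kappa * u n) ^+ M.+1 / (M.+1)`!%:R <= expR (kappa * u n).
    by apply: le_trans (expR_ge1Dxn M (ltW ku0)); rewrite lerDr.
  rewrite powR_inv1 ?ler0n // expRN ler_pdivlMr //.
  rewrite mulrAC -exprSr ler_pdivrMr ?expR_gt0 //.
  rewrite /C mulrAC ler_pdivlMr ?exprn_gt0 //.
  move: ex; rewrite ler_pdivrMr ?ltr0n ?fact_gt0 // => ex.
  rewrite [leRHS]mulrC; apply: le_trans ex; rewrite exprMn mulrC.
  by rewrite ler_pM2l ?exprn_gt0.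
- exact: cvg_cst.
- by rewrite -(mulr0 C); apply: cvgMl_tmp; exact: cvg_powRN0.
Unshelve. all: by end_near.
Qed.

Lemma aas_of_bound (r : nat) (a : nat -> 'rV[R]_r.+1)
    (E : forall n : nat, classical_sets.set {set {set 'I_n}}) (err : nat -> R) :
    (forall n, nonneg (a n)) -> (err @ \oo --> (0 : R))%classic ->
    (\forall n \near \oo%classic, 1 - err n <= Pr (prob_of_exponents a n) (E n)) ->
  aas (prob_of_exponents a) E.
Proof.
move=> a0 err0 H.
apply: (@squeeze_cvgr _ _ _ _ (fun n => 1 - err n) (fun=> 1)).
- near=> n; apply/andP; split; first by near: n.
  apply: Pr_le1 => i; apply: face_prob_itv; last exact: a0.
  by near: n; exact: nbhs_infty_gt.
- by rewrite -[X in (_ --> X)%classic](subr0 1); apply: cvgB => //; exact: cvg_cst.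
- exact: cvg_cst.
Unshelve. all: by end_near.
Qed.

End Asymptotics.

Section Corollary.
Variables (R : realType) (r : nat) (a : nat -> 'rV[R]_r.+1) (astar : 'rV[R]_r.+1).
Hypotheses (a0 : forall n, nonneg (a n)) (a_cvg : (a @ \oo --> astar)%classic).
Variable d : nat.

(** [E] is left arbitrary because two formulations of the conclusion are needed. *)
Lemma aas_all_degrees (delta : R)
    (E : forall n : nat, classical_sets.set {set {set 'I_n}}) :
    0 < delta < 1 -> (d < r)%N -> psi d.+1 astar < 1 ->
    (forall n Y, (forall x, x \in faces d Y ->
       `|(deg Y x)%:R - mu n d (a n)| <= delta * mu n d (a n)) -> E n Y) ->
  aas (prob_of_exponents a) E.
Proof.
move=> delta01 dr psi1 EP; have /andP[d0 d1] := delta01.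
pose c0 := (1 - psi d.+1 astar) / 2.
have c00 : 0 < c0 by rewrite /c0; lra.
have mu_big : \forall n \near \oo%classic, n%:R `^ c0 <= mu n d (a n) :> R.
  near=> n.
  have n0 : (0 < n)%N by near: n; exact: nbhs_infty_gt.
  have : psi d.+1 (a n) < 1 - c0.
    by near: n; apply: (cvgr_lt (psi d.+1 astar) (cvg_psi a_cvg)); rewrite /c0; lra.
  by move=> H; rewrite /mu ler_powR ?ler1n //; lra.
pose term c n : R := n%:R ^+ d.+1 * expR (- (cramer_rate c * mu n d (a n))).
have term0 c : -1 < c -> c != 0 -> (term c @ \oo --> (0 : R))%classic.
  move=> c1 cn0; exact: (@cvg_poly_expR0 _ _ _ d.+1 _ (cramer_rate_gt0 c1 cn0) c00 mu_big).
apply: (aas_of_bound (err := fun n => expR (delta * d.+1%:R) *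
  (term delta n + term (- delta) n)) a0).
  rewrite (_ : 0 = expR (delta * d.+1%:R) * (0 + 0)); last by rewrite addr0 mulr0.
  apply: cvgMl_tmp; apply: cvgD; apply: term0; rewrite ?oppr_eq0 ?gt_eqF //; lra.
near=> n.
have n0 : (0 < n)%N by near: n; exact: nbhs_infty_gt.
apply: le_trans (Pr_all_degrees_ge n0 (a0 n) dr delta01 (EP n)).
rewrite lerD2l lerN2 /term le_eqVlt; apply/orP; left; apply/eqP; ring.
Unshelve. all: by end_near.
Qed.

Lemma aas_most_faces_isolated :
    (d <= r)%N -> nonneg astar -> 0 < tau d astar -> ((d < r)%N -> 1 < psi d.+1 astar) ->
  exists t : nat -> R,
    [/\ forall n : nat, 0 < t n, (t @ \oo --> (0 : R))%classic &
        aas (prob_of_exponents a)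
          (fun n Y => (0 < #|faces d Y|)%N /\
             1 - t n < #|faces_deg d 0 Y|%:R / #|faces d Y|%:R)].
Proof.
move=> dr astar0 tau0 psi_gt1.
pose c' := if (d < r)%N then (psi d.+1 astar - 1) / 2 else 1.
have c'0 : 0 < c' by rewrite /c'; case: ifP => // /psi_gt1; lra.
(* The second term only serves to make [eps n] positive at [n = 0]; for [d = r]
   the value of [c'] is arbitrary. *)
pose eps n : R := n%:R `^ (- c') + n.+1%:R^-1.
have eps0 n : 0 < eps n by rewrite ltr_wpDl ?powR_ge0 // invr_gt0 ltr0n.
have seps_cvg : ((fun n => Num.sqrt (eps n)) @ \oo --> (0 : R))%classic.
  rewrite -(sqrtr0 R); apply: continuous_cvg; first exact: sqrt_continuous.
  rewrite -(addr0 0); apply: cvgD; first exact: cvg_powRN0.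
  exact: cvg_harmonic.
exists (fun n => 2 * Num.sqrt (eps n)); split.
- by move=> n; rewrite mulr_gt0 // sqrtr_gt0.
- by rewrite -(mulr0 2); exact: cvgMl_tmp.
have psi_near : \forall n \near \oo%classic, (d < r)%N -> 1 + c' < psi d.+1 (a n).
  have [dr'|_] := ltnP d r; last by near=> n.
  have : \forall n \near \oo%classic, 1 + c' < psi d.+1 (a n).
    apply: (cvgr_gt (psi d.+1 astar) (cvg_psi a_cvg)).
    by rewrite /c' dr'; have := psi_gt1 dr'; lra.
  by apply: filterS.
have psi0 : 0 < 1 - psi 0 astar.
  have := tau_le_psi0 d astar0; move/(lt_le_trans tau0).
  by rewrite pmulr_rgt0 // ltr0n.
pose c := Num.min (1 - psi 0 astar) (tau d astar) / 2.
have [c0 c1 c2] : [/\ 0 < c, c < 1 - psi 0 astar & c < tau d astar].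
  have : 0 < Num.min (1 - psi 0 astar) (tau d astar) by rewrite lt_min psi0.
  have : Num.min (1 - psi 0 astar) (tau d astar) <= 1 - psi 0 astar by rewrite ge_min lexx.
  have : Num.min (1 - psi 0 astar) (tau d astar) <= tau d astar by rewrite ge_min lexx orbT.
  by rewrite /c; split; lra.
apply: (aas_of_bound (err := fun n => 4 * variance_bound n d c + Num.sqrt (eps n)) a0).
  rewrite -[X in (_ --> X)%classic](addr0 0); apply: cvgD => //.
  rewrite -(mulr0 4); apply: cvgMl_tmp; rewrite -(mulr0 ((2 * d.+1)%:R ^+ d.+1)).
  by apply: cvgMl_tmp; exact: cvg_powRN0.
near=> n.
have n0 : (0 < n)%N by near: n; exact: nbhs_infty_gt.
have dn : (d < n)%N by near: n; exact: nbhs_infty_gt.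
have psi0n : psi 0 (a n) < 1 - c.
  by near: n; apply: (cvgr_lt (psi 0 astar) (cvg_psi a_cvg)); lra.
have taun : c < tau d (a n) by near: n; exact: (cvgr_gt (tau d astar) (cvg_tau a_cvg)).
apply: (Pr_most_faces_isolated_ge n0 (a0 n) dr dn (eps0 n)).
- by move=> j jd; apply: (le_tau_min (a0 n) jd); lra.
- have M0 : 0 <= mean_faces n (a n) d by rewrite mulr_ge0 ?powR_ge0 ?ler0n.
  have [dr'|dr'] := ltnP d r; last first.
    rewrite Ex_covered_faces_top; first by rewrite mulr_ge0 // ltW.
    by apply/eqP; rewrite eqn_leq dr.
  apply: (le_trans (Ex_covered_faces_le n0 (a0 n) dr')).
  rewrite ler_wpM2l // /eps (@le_trans _ _ (n%:R `^ (- c'))) //; last first.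
    by rewrite lerDl invr_ge0 ler0n.
  have : (d < r)%N -> 1 + c' < psi d.+1 (a n) by near: n.
  by move=> /(_ dr') H; rewrite ler_powR ?ler1n //; lra.
- by [].
Unshelve. all: by end_near.
Qed.

End Corollary.

Theorem corollary11 (R : realType) (r : nat)
    (a : nat -> 'rV[R]_r.+1) (a_nonneg : forall n : nat, nonneg (a n))
    (astar : 'rV[R]_r.+1) (a_cvg : (a @ \oo --> astar)%classic)
    (k : nat) (k_le_r : (k <= r)%N) (astar_dom : Dom k astar)
    (d : nat) (d_le_r : (d <= r)%N)
    (delta : R) (delta_bounds : 0 < delta < 1) :
  ((d < k)%N -> 0 < psi d.+1 astar ->
     aas (prob_of_exponents a)
       (fun n Y => (\esum_(s in Tset (mu n d (a n)) delta)
                      (#|faces_deg d s Y|%:R)%:E = 0 :> \bar R)%E) /\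
     aas (prob_of_exponents a)
       (fun n Y => forall x : {set 'I_n}, x \in faces d Y ->
          `|(deg Y x)%:R - mu n d (a n)| <= delta * mu n d (a n)))
  /\
  ((k <= d)%N -> 0 < tau d astar ->
     exists t : nat -> R,
       [/\ forall n : nat, 0 < t n,
           (t @ \oo --> (0 : R))%classic &
           aas (prob_of_exponents a)
             (fun n Y => (0 < #|faces d Y|)%N /\
                1 - t n < #|faces_deg d 0 Y|%:R / #|faces d Y|%:R)]).
Proof.
have astar0 : nonneg astar by move: astar_dom; rewrite /Dom; case: ifP => _ [].
have psik : psi k astar < 1.
  by move: astar_dom; rewrite /Dom; case: ifP => _ [_] // /andP[].
split=> [dk _|kd tau0].
  have psid : psi d.+1 astar < 1 by apply: le_lt_trans psik; exact: le_psi.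
  have dr : (d < r)%N by exact: leq_trans k_le_r.
  split; apply: (aas_all_degrees a_nonneg a_cvg delta_bounds dr psid) => n Y HY //.
  apply: esum1 => s /= bad; rewrite (_ : #|_| = 0%N) //; apply: eq_card0 => x.
  rewrite inE; apply/negP => /andP[/HY H /eqP dx]; move: bad.
  by rewrite /Tset /= ltNge -dx H.
apply: (aas_most_faces_isolated a_nonneg a_cvg) => // dr.
move: astar_dom; rewrite /Dom (leq_ltn_trans kd dr) => -[_ /andP[_ psi1]].
by apply: lt_le_trans psi1 _; exact: le_psi.
Qed.
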